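(* Let $\Omega$ be a nonempty set, $(A,\rho_\Omega)$ an $\Omega$-operated $\mathbf{k}$-algebra and $Y$ a set. (1) Elements in $\mathfrak{I}(\Omega,A[Y])\setminus J_{\rho_\Omega}$ give operator equations that do not hold identically in $(A,\rho_\Omega)$; that is, if $\phi\in\mathfrak{I}(\Omega,A[Y])\setminus J_{\rho_\Omega}$ then there is a map $f_Y:Y\to A$ that is not a solution of $\phi=0$ in $(A,\rho_\Omega)$. (2) Two operator equations $\phi=0$ and $\psi=0$, with $\phi,\psi\in\mathfrak{I}(\Omega,A[Y])$, have the same solution set in $(A,\rho_\Omega)$ if $\phi-\psi\in J_{\rho_\Omega}$.
   Context: $\mathbf{k}$ is a field of characteristic $0$; algebras are commutative unital $\mathbf{k}$-algebras (except augmentation parts). $A[Y]=A\otimes\mathbf{k}[Y]$, $A[Y]^+=A\otimes\mathbf{k}[Y]^+$ where $\mathbf{k}[Y]^+$ is the set of polynomials with zero constant term. An $\Omega$-operated algebra is an algebra $V$ with linear maps $P_\omega:V\to V$, $\omega\in\Omega$; homomorphisms are algebra homomorphisms commuting with the operators. An $(A,\rho_\Omega)$-algebra is an $\Omega$-operated algebra $(R,P_\Omega)$ with an $\Omega$-operated algebra homomorphism $j_R:(A,\rho_\Omega)\to(R,P_\Omega)$; homomorphisms of these are $\Omega$-operated homomorphisms compatible with the maps from $A$. Construction of $\mathfrak{I}(\Omega,A[Y])$. For a module $V$, $\lfloor V\rfloor_\omega$ is a copy of $V$ with linear bijection $v\mapsto\lfloor v\rfloor_\omega$, $\lfloor V\rfloor_\Omega=\bigoplus_\omega\lfloor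 V\rfloor_\omega$, $S(V)$ is the symmetric algebra and $S^+(V)=\bigoplus_{n\ge1}S^n(V)$. Set $\mathfrak{I}_0=A[Y]$, $\mathfrak{I}_0^+=A[Y]^+$ and, for $n\ge0$, $\mathfrak{I}_{n+1}=A[Y]\otimes S(\lfloor\mathfrak{I}_n^+\rfloor_\Omega)=A\oplus\mathfrak{I}_{n+1}^+$ with $\mathfrak{I}_{n+1}^+=A[Y]^+\oplus(A[Y]\otimes S^+(\lfloor\mathfrak{I}_n^+\rfloor_\Omega))$, with the natural inclusions. Then $\mathfrak{I}(\Omega,A[Y])=\bigcup_n\mathfrak{I}_n=A\oplus\mathfrak{I}^+$, $\mathfrak{I}^+=\bigcup_n\mathfrak{I}_n^+$, with $\Pi_\omega(u)=\rho_\omega(u)$ for $u\in A$ and $\Pi_\omega(u)=\lfloor u\rfloor_\omega$ for $u\in\mathfrak{I}^+$. It is the free $(A,\rho_\Omega)$-algebra over $\mathbf{k}[Y]$: for any $(A,\rho_\Omega)$-algebra $R$, any map $Y\to R$ extends uniquely to an $(A,\rho_\Omega)$-algebra homomorphism $\mathfrak{I}(\Omega,A[Y])\to R$. An operator equation is an equation $\phi=0$ with $\phi\in\mathfrak{I}(\Omega,A[Y])$. For $f_Y:Y\to A$, the evaluation map $\bar f:\mathfrak{I}(\Omega,A[Y])\to A$ is the unique $(A,\rho_\Omega)$-algebra homomorphism extending $f_Y$ ($A$ with identity structure map). $f_Y$ is a solution of $\phi=0$ in $(A,\rho_\Omega)$ if $\bar f(\phi)=0$. $J_{\rho_\Omega,f_Y}:=\ker\bar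 f$ and $J_{\rho_\Omega}:=\bigcap_{f_Y:Y\to A}J_{\rho_\Omega,f_Y}$. *)

(* Defs.v *)
From HB Require Import structures.
From mathcomp Require Import all_boot all_order all_algebra.
From mathcomp Require Import boolp classical_sets.
From mathcomp Require Import finmap.
From mathcomp.multinomials Require Import monalg.

Set Implicit Arguments.
Unset Strict Implicit.
Unset Printing Implicit Defensive.

Import GRing.Theory.
Local Open Scope ring_scope.
Local Open Scope quotient_scope.

(* A commutative unital k-algebra, as a commutative ring with a ring morphism
   from k. MathComp's [comAlgType k] is not used directly because it excludes
   the zero algebra; see [ualg_of] for the embedding. *)
Record comUAlg (k : fieldType) := ComUAlg {
  ualg_ring : comPzRingType;
  ualg_struct : {rmorphism k -> ualg_ring}
}.

Definition ualg_sort (k : fieldType) (A : comUAlg k) : Type := ualg_ring A.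
Coercion ualg_sort : comUAlg >-> Sortclass.

HB.instance Definition _ (k : fieldType) (A : comUAlg k) :=
  GRing.ComPzRing.on (ualg_sort A).

Section UAlgModule.
Variables (k : fieldType) (A : comUAlg k).

Definition ualg_scale (c : k) (x : A) : A := (ualg_struct A c : A) * x.

Lemma ualg_scaleA a b v : ualg_scale a (ualg_scale b v) = ualg_scale (a * b) v.
Proof. by rewrite /ualg_scale mulrA rmorphM. Qed.
Lemma ualg_scale1 : left_id 1 ualg_scale.
Proof. by move=> x; rewrite /ualg_scale rmorph1 mul1r. Qed.
Lemma ualg_scaleDr : right_distributive ualg_scale +%R.
Proof. by move=> c x y; rewrite /ualg_scale mulrDr. Qed.
Lemma ualg_scaleDl v : {morph ualg_scale^~ v : a b / a + b}.
Proof. by move=> a b; rewrite /ualg_scale rmorphD mulrDl. Qed.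

HB.instance Definition _ := GRing.Zmodule_isLmodule.Build k (ualg_sort A)
  ualg_scaleA ualg_scale1 ualg_scaleDr ualg_scaleDl.

Lemma ualg_scaleE (c : k) (x : A) : c *: x = (ualg_struct A c : A) * x.
Proof. by []. Qed.
Lemma ualgZl (c : k) (x y : A) : (c *: x) * y = c *: (x * y).
Proof. by rewrite !ualg_scaleE mulrA. Qed.
Lemma ualgZr (c : k) (x y : A) : x * (c *: y) = c *: (x * y).
Proof. by rewrite mulrC ualgZl mulrC. Qed.
End UAlgModule.

Definition ualg_of (k : fieldType) (A : comAlgType k) : comUAlg k :=
  @ComUAlg k A (in_alg A).

Record algHom (k : fieldType) (A B : comUAlg k) := AlgHom {
  hom_fun :> A -> B;
  hom_linear : linear hom_fun;
  hom_mult : monoid_morphism hom_fun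
}.
HB.instance Definition _ k A B (f : @algHom k A B) :=
  GRing.isLinear.Build k A B *:%R f (hom_linear f).
HB.instance Definition _ k A B (f : @algHom k A B) :=
  GRing.isMonoidMorphism.Build A B f (hom_mult f).

Section AlgHomTheory.
Variable k : fieldType.
Implicit Types A B C : comUAlg k.

Lemma algHomP A B (f : algHom A B) (c : k) x y :
  f (c *: x + y) = c *: f x + f y.
Proof. exact: linearP. Qed.
Lemma algHomD A B (f : algHom A B) x y : f (x + y) = f x + f y.
Proof. exact: raddfD. Qed.
Lemma algHomB A B (f : algHom A B) x y : f (x - y) = f x - f y.
Proof. exact: raddfB. Qed.
Lemma algHomM A B (f : algHom A B) x y : f (x * y) = f x * f y.
Proof. exact: rmorphM. Qed.

Lemma algHom_cst A B (f : algHom A B) (c : k) : f (c *: (1 : A)) = c *: (1 : B).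
Proof. by rewrite linearZ rmorph1. Qed.

Lemma hom_id_linear A : linear (fun x : A => x). Proof. by []. Qed.
Lemma hom_id_mult A : monoid_morphism (fun x : A => x). Proof. by []. Qed.
Definition hom_id A := AlgHom (@hom_id_linear A) (@hom_id_mult A).

Lemma hom_comp_linear A B C (g : algHom B C) (f : algHom A B) :
  linear (fun x => g (f x)).
Proof. by move=> c x y; rewrite !linearP. Qed.
Lemma hom_comp_mult A B C (g : algHom B C) (f : algHom A B) :
  monoid_morphism (fun x => g (f x)).
Proof. by split=> [|x y]; rewrite ?rmorph1 ?rmorphM. Qed.
Definition hom_comp A B C (g : algHom B C) (f : algHom A B) :=
  AlgHom (hom_comp_linear g f) (hom_comp_mult g f).
End AlgHomTheory.

Section Span.
Variables (k : fieldType) (V : lmodType k).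

Inductive in_lspan (X : set V) : V -> Prop :=
| in_lspan0 : in_lspan X 0
| in_lspanS (c : k) x y : X x -> in_lspan X y -> in_lspan X (c *: x + y).

Definition lspan (X : set V) : {pred V} := fun x => `[< in_lspan X x >].

Lemma lspanP X x : reflect (in_lspan X x) (x \in lspan X).
Proof. exact: asboolP. Qed.

Lemma lspan_closed X : subsemimod_closed (lspan X).
Proof.
split; first split.
- by apply/lspanP/in_lspan0.
- move=> x y /lspanP hx /lspanP hy; apply/lspanP.
  elim: hx => [|c x1 y1 h1 _ ih]; first by rewrite add0r.
  by rewrite -addrA; apply: in_lspanS.
- move=> c x /lspanP; elim=> [|d x1 y1 h1 _ /lspanP ih].
    by rewrite scaler0; apply/lspanP/in_lspan0.
  by apply/lspanP; rewrite scalerDr scalerA; apply: in_lspanS.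
Qed.

HB.instance Definition _ X := GRing.isSubmodClosed.Build k V (lspan X)
  (lspan_closed X).

Lemma mem_lspan (X : set V) x : X x -> x \in lspan X.
Proof.
move=> hx; apply/lspanP; rewrite -[x]addr0 -[x]scale1r.
by apply: in_lspanS => //; apply: in_lspan0.
Qed.

Record subm (S : submodClosed V) := Subm { subm_val : V; _ : subm_val \in S }.
Variable S : submodClosed V.
HB.instance Definition _ := [isSub for @subm_val S].
HB.instance Definition _ := [Choice of subm S by <:].
HB.instance Definition _ := [SubChoice_isSubLmodule of subm S by <:].
End Span.


(* The commutative k-algebra with generators G and relations R: formal
   expressions modulo the least congruence containing R and the axioms of
   commutative k-algebras. *)
Section Presentation.
Variables (k : fieldType) (G : Type).

Inductive expr :=
| Gen of G
| Cst of k
| Add of expr & expr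
| Opp of expr
| Mul of expr & expr.

HB.instance Definition _ := gen_eqMixin expr.
HB.instance Definition _ := gen_choiceMixin expr.

Variable R : expr -> expr -> Prop.

Inductive pres_eq : expr -> expr -> Prop :=
| pe_rel x y : R x y -> pres_eq x y
| pe_refl x : pres_eq x x
| pe_sym x y : pres_eq x y -> pres_eq y x
| pe_trans y x z : pres_eq x y -> pres_eq y z -> pres_eq x z
| pe_add x x' y y' :
    pres_eq x x' -> pres_eq y y' -> pres_eq (Add x y) (Add x' y')
| pe_opp x x' : pres_eq x x' -> pres_eq (Opp x) (Opp x')
| pe_mul x x' y y' :
    pres_eq x x' -> pres_eq y y' -> pres_eq (Mul x y) (Mul x' y')
| pe_addA x y z : pres_eq (Add x (Add y z)) (Add (Add x y) z)
| pe_addC x y : pres_eq (Add x y) (Add y x)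
| pe_add0 x : pres_eq (Add (Cst 0) x) x
| pe_addN x : pres_eq (Add (Opp x) x) (Cst 0)
| pe_mulA x y z : pres_eq (Mul x (Mul y z)) (Mul (Mul x y) z)
| pe_mulC x y : pres_eq (Mul x y) (Mul y x)
| pe_mul1 x : pres_eq (Mul (Cst 1) x) x
| pe_mulD x y z : pres_eq (Mul (Add x y) z) (Add (Mul x z) (Mul y z))
| pe_cstD a b : pres_eq (Cst (a + b)) (Add (Cst a) (Cst b))
| pe_cstM a b : pres_eq (Cst (a * b)) (Mul (Cst a) (Cst b)).

Definition pres_eqb : rel expr := fun x y => `[< pres_eq x y >].
Lemma pres_eqb_refl : reflexive pres_eqb.
Proof. by move=> x; apply/asboolP/pe_refl. Qed.
Lemma pres_eqb_sym : symmetric pres_eqb.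
Proof. by move=> x y; apply: asbool_equiv_eq; split; apply: pe_sym. Qed.
Lemma pres_eqb_trans : transitive pres_eqb.
Proof.
by move=> y x z /asboolP h /asboolP h'; apply/asboolP/(pe_trans h h').
Qed.
Canonical pres_equiv := EquivRel pres_eqb
  pres_eqb_refl pres_eqb_sym pres_eqb_trans.

Definition pres_sort := {eq_quot pres_equiv}.
HB.instance Definition _ := Choice.on pres_sort.

Definition pcl (x : expr) : pres_sort := \pi_({eq_quot pres_equiv}) x.

Lemma pclP x y : pcl x = pcl y <-> pres_eq x y.
Proof. by split=> [/eqmodP/asboolP|h] //; apply/eqmodP/asboolP. Qed.

Definition prepr (x : pres_sort) : expr := repr (x : {eq_quot pres_equiv}).
Lemma preprK x : pcl (prepr x) = x.
Proof. exact: reprK. Qed.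
Lemma pclK x : pres_eq (prepr (pcl x)) x.
Proof. by apply/pclP; rewrite preprK. Qed.
Lemma pclW (P : pres_sort -> Prop) : (forall x, P (pcl x)) -> forall x, P x.
Proof. by move=> h x; rewrite -(preprK x). Qed.

Definition pres_add x y := pcl (Add (prepr x) (prepr y)).
Definition pres_opp x := pcl (Opp (prepr x)).
Definition pres_mul x y := pcl (Mul (prepr x) (prepr y)).
Lemma pclD x y : pcl (Add x y) = pres_add (pcl x) (pcl y).
Proof. by apply/pclP/pe_sym/pe_add; apply: pclK. Qed.
Lemma pclN x : pcl (Opp x) = pres_opp (pcl x).
Proof. by apply/pclP/pe_sym/pe_opp/pclK. Qed.
Lemma pclM x y : pcl (Mul x y) = pres_mul (pcl x) (pcl y).
Proof. by apply/pclP/pe_sym/pe_mul; apply: pclK. Qed.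

Lemma pres_addA : associative pres_add.
Proof.
elim/pclW=> x; elim/pclW=> y; elim/pclW=> z.
by rewrite -!pclD; apply/pclP/pe_addA.
Qed.
Lemma pres_addC : commutative pres_add.
Proof. by elim/pclW=> x; elim/pclW=> y; rewrite -!pclD; apply/pclP/pe_addC. Qed.
Lemma pres_add0 : left_id (pcl (Cst 0)) pres_add.
Proof. by elim/pclW=> x; rewrite -!pclD; apply/pclP/pe_add0. Qed.
Lemma pres_addN : left_inverse (pcl (Cst 0)) pres_opp pres_add.
Proof. by elim/pclW=> x; rewrite -pclN -pclD; apply/pclP/pe_addN. Qed.
Lemma pres_mulA : associative pres_mul.
Proof.
elim/pclW=> x; elim/pclW=> y; elim/pclW=> z.
by rewrite -!pclM; apply/pclP/pe_mulA.
Qed.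
Lemma pres_mulC : commutative pres_mul.
Proof. by elim/pclW=> x; elim/pclW=> y; rewrite -!pclM; apply/pclP/pe_mulC. Qed.
Lemma pres_mul1 : left_id (pcl (Cst 1)) pres_mul.
Proof. by elim/pclW=> x; rewrite -!pclM; apply/pclP/pe_mul1. Qed.
Lemma pres_mulD : left_distributive pres_mul pres_add.
Proof.
elim/pclW=> x; elim/pclW=> y; elim/pclW=> z.
by rewrite -!(pclD, pclM); apply/pclP/pe_mulD.
Qed.

HB.instance Definition _ := GRing.isZmodule.Build pres_sort
  pres_addA pres_addC pres_add0 pres_addN.
HB.instance Definition _ := GRing.Zmodule_isComPzRing.Build pres_sort
  pres_mulA pres_mulC pres_mul1 pres_mulD.

Definition pres_cst (c : k) : pres_sort := pcl (Cst c).
Lemma pres_cstD (a b : k) : pres_cst (a + b) = pres_cst a + pres_cst b.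
Proof. by rewrite -[RHS]pclD; apply/pclP/pe_cstD. Qed.
Lemma pres_cst_additive : zmod_morphism pres_cst.
Proof. by move=> a b; rewrite -[in RHS](subrK b a) [in RHS]pres_cstD addrK. Qed.
Lemma pres_cst_mult : monoid_morphism pres_cst.
Proof. by split=> // a b; rewrite -[RHS]pclM; apply/pclP/pe_cstM. Qed.
HB.instance Definition _ := GRing.isZmodMorphism.Build k pres_sort
  pres_cst pres_cst_additive.
HB.instance Definition _ := GRing.isMonoidMorphism.Build k pres_sort
  pres_cst pres_cst_mult.

Definition presAlg : comUAlg k := @ComUAlg k pres_sort pres_cst.
Definition pgen (g : G) : presAlg := pcl (Gen g).
End Presentation.

Section PresentationLift.
Variables (k : fieldType) (G : Type) (R : expr k G -> expr k G -> Prop).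

Lemma pgenD x y : pcl R (Add x y) = pcl R x + pcl R y :> presAlg R.
Proof. exact: pclD. Qed.
Lemma pgenM x y : pcl R (Mul x y) = pcl R x * pcl R y :> presAlg R.
Proof. exact: pclM. Qed.
Lemma pgenN x : pcl R (Opp x) = - pcl R x :> presAlg R.
Proof. exact: pclN. Qed.
Lemma pgenC c : pcl R (Cst G c) = c *: (1 : presAlg R) :> presAlg R.
Proof. by rewrite ualg_scaleE mulr1. Qed.
Lemma pgenZ c x :
  pcl R (Mul (Cst G c) x) = c *: (pcl R x : presAlg R) :> presAlg R.
Proof. exact: pclM. Qed.

Lemma pres_rel x y : R x y -> pcl R x = pcl R y.
Proof. by move=> h; apply/pclP/pe_rel. Qed.

Lemma presAlg_ind (P : presAlg R -> Prop) :
  (forall g, P (pgen R g)) -> (forall c : k, P (c *: (1 : presAlg R))) ->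
  (forall x y, P x -> P y -> P (x + y)) ->
  (forall x y, P x -> P y -> P (x * y)) -> forall x, P x.
Proof.
move=> hg hc hD hM; apply: pclW; elim=> [g|c|x hx y hy|x hx|x hx y hy].
- exact: hg.
- by rewrite pgenC; apply: hc.
- by rewrite pgenD; apply: hD.
- have -> : pcl R (Opp x) = (-1) *: (1 : presAlg R) * pcl R x :> presAlg R.
    by rewrite pgenN ualgZl mul1r scaleN1r.
  exact: hM.
- by rewrite pgenM; apply: hM.
Qed.

Variables (B : comUAlg k) (h : G -> B).

Fixpoint interp (x : expr k G) : B :=
  match x with
  | Gen g => h g
  | Cst c => c *: (1 : B)
  | Add x y => interp x + interp y
  | Opp x => - interp x
  | Mul x y => interp x * interp y
  end.

Hypothesis hR : forall x y, R x y -> interp x = interp y.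

Lemma interp_eq x y : pres_eq R x y -> interp x = interp y.
Proof.
elim=> {x y} //=.
- by move=> y x z _ -> _ ->.
- by move=> x x' y y' _ -> _ ->.
- by move=> x x' _ ->.
- by move=> x x' y y' _ -> _ ->.
- by move=> x y z; rewrite addrA.
- by move=> x y; rewrite addrC.
- by move=> x; rewrite scale0r add0r.
- by move=> x; rewrite scale0r addNr.
- by move=> x y z; rewrite mulrA.
- by move=> x y; rewrite mulrC.
- by move=> x; rewrite scale1r mul1r.
- by move=> x y z; rewrite mulrDl.
- by move=> a b; rewrite scalerDl.
- by move=> a b; rewrite ualgZl mul1r scalerA.
Qed.

Definition pres_lift_fun (x : presAlg R) : B := interp (prepr x).
Lemma pres_lift_cl x : pres_lift_fun (pcl R x) = interp x.
Proof. exact/interp_eq/pclK. Qed.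

Lemma pres_lift_linear : linear pres_lift_fun.
Proof.
move=> c; apply: pclW=> x; apply: pclW=> y.
by rewrite -pgenZ -pgenD !pres_lift_cl /= ualgZl mul1r.
Qed.
Lemma pres_lift_mult : monoid_morphism pres_lift_fun.
Proof.
split; first by rewrite pres_lift_cl /= scale1r.
by apply: pclW=> x; apply: pclW=> y; rewrite -pgenM !pres_lift_cl.
Qed.
Definition pres_lift : algHom (presAlg R) B :=
  AlgHom pres_lift_linear pres_lift_mult.
Lemma pres_liftE g : pres_lift (pgen R g) = h g.
Proof. exact: pres_lift_cl. Qed.
End PresentationLift.

(* E (x) F, generated by the symbols x (x) y subject to bilinearity and to
   (x (x) y)(x' (x) y') = xx' (x) yy', 1 (x) 1 = 1; by the last two relations
   every element is a sum of pure tensors ([tens_ind]), so that this is the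
   tensor product of modules with its usual product. *)
Section Tensor.
Variables (k : fieldType) (E F : comUAlg k).

Inductive tens_rel : expr k (E * F) -> expr k (E * F) -> Prop :=
| tens_addl x x' y :
    tens_rel (Gen k (x + x', y)) (Add (Gen k (x, y)) (Gen k (x', y)))
| tens_addr x y y' :
    tens_rel (Gen k (x, y + y')) (Add (Gen k (x, y)) (Gen k (x, y')))
| tens_scalel c x y :
    tens_rel (Gen k (c *: x, y)) (Mul (Cst _ c) (Gen k (x, y)))
| tens_scaler c x y :
    tens_rel (Gen k (x, c *: y)) (Mul (Cst _ c) (Gen k (x, y)))
| tens_mul x x' y y' :
    tens_rel (Gen k (x * x', y * y')) (Mul (Gen k (x, y)) (Gen k (x', y')))
| tens_one : tens_rel (Gen k (1, 1)) (Cst _ 1).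

Definition tens : comUAlg k := presAlg tens_rel.
Definition pt (x : E) (y : F) : tens := pgen tens_rel (x, y).

Lemma pt1 : pt 1 1 = 1.
Proof. by rewrite /pt /pgen (pres_rel tens_one). Qed.
Lemma ptM x x' y y' : pt (x * x') (y * y') = pt x y * pt x' y'.
Proof. by rewrite /pt /pgen (pres_rel (tens_mul _ _ _ _)) pgenM. Qed.
Lemma ptDl x x' y : pt (x + x') y = pt x y + pt x' y.
Proof. by rewrite /pt /pgen (pres_rel (tens_addl _ _ _)) pgenD. Qed.
Lemma ptDr x y y' : pt x (y + y') = pt x y + pt x y'.
Proof. by rewrite /pt /pgen (pres_rel (tens_addr _ _ _)) pgenD. Qed.
Lemma ptZl c x y : pt (c *: x) y = c *: pt x y.
Proof. by rewrite /pt /pgen (pres_rel (tens_scalel _ _ _)) pgenZ. Qed.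
Lemma ptZr c x y : pt x (c *: y) = c *: pt x y.
Proof. by rewrite /pt /pgen (pres_rel (tens_scaler _ _ _)) pgenZ. Qed.

Lemma tens_ind (P : tens -> Prop) :
  (forall x y, P (pt x y)) -> (forall x y, P x -> P y -> P (x + y)) ->
  forall x, P x.
Proof.
move=> hp hD x.
have h0 : P 0 by rewrite -[0](scale0r (pt 1 1)) -ptZl.
suff [l ->] : exists l : seq (E * F), x = \sum_(u <- l) pt u.1 u.2.
  elim: l => [|u l ih]; first by rewrite big_nil.
  by rewrite big_cons; apply: hD.
elim/presAlg_ind: x => [[x y]|c|_ _ [l ->] [l' ->]|_ _ [l ->] [l' ->]].
- by exists [:: (x, y)]; rewrite big_seq1.
- by exists [:: (c *: (1 : E), 1)]; rewrite big_seq1 ptZl pt1.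
- by exists (l ++ l'); rewrite big_cat.
- exists [seq (u.1 * v.1, u.2 * v.2) | u <- l, v <- l'].
  rewrite big_allpairs_dep mulr_suml; apply: eq_bigr=> u _.
  by rewrite mulr_sumr; apply: eq_bigr=> v _; rewrite ptM.
Qed.

Lemma inl_linear : linear (pt^~ 1).
Proof. by move=> c x y /=; rewrite ptDl ptZl. Qed.
Lemma inl_mult : monoid_morphism (pt^~ 1).
Proof. by split=> [|x y] /=; rewrite ?pt1 // -ptM mulr1. Qed.
Definition tens_inl : algHom E tens := AlgHom inl_linear inl_mult.
Lemma inr_linear : linear (pt 1).
Proof. by move=> c x y /=; rewrite ptDr ptZr. Qed.
Lemma inr_mult : monoid_morphism (pt 1).
Proof. by split=> [|x y] /=; rewrite ?pt1 // -ptM mulr1. Qed.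
Definition tens_inr : algHom F tens := AlgHom inr_linear inr_mult.

Variables (B : comUAlg k) (f : algHom E B) (g : algHom F B).
Lemma tens_compat x y : tens_rel x y ->
  interp (fun u => f u.1 * g u.2) x = interp (fun u => f u.1 * g u.2) y.
Proof.
case=> {x y} /= *.
- by rewrite raddfD mulrDl.
- by rewrite raddfD mulrDr.
- by rewrite linearZ ualgZl ualgZl mul1r.
- by rewrite linearZ ualgZl ualgZr mul1r.
- by rewrite !rmorphM mulrACA.
- by rewrite !rmorph1 mulr1 scale1r.
Qed.
Definition tens_lift : algHom tens B := pres_lift tens_compat.
Lemma tens_liftE x y : tens_lift (pt x y) = f x * g y.
Proof. exact: pres_liftE. Qed.
End Tensor.

(* The symmetric algebra S(V), its graded pieces S^n(V), and S^+(V), spanned by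
   the S^n(V) with n >= 1. *)
Section Symmetric.
Variables (k : fieldType) (V : lmodType k).

Inductive sym_rel : expr k V -> expr k V -> Prop :=
| sym_add v w : sym_rel (Gen k (v + w)) (Add (Gen k v) (Gen k w))
| sym_scale c v : sym_rel (Gen k (c *: v)) (Mul (Cst _ c) (Gen k v)).

Definition sym : comUAlg k := presAlg sym_rel.
Definition sgen (v : V) : sym := pgen sym_rel v.
Lemma sgen_linear : linear sgen.
Proof.
move=> c v w; rewrite /sgen /pgen (pres_rel (sym_add _ _)) pgenD.
by rewrite (pres_rel (sym_scale _ _)) pgenZ.
Qed.
HB.instance Definition _ := GRing.isLinear.Build k V sym *:%R sgen sgen_linear.

Definition sym_deg (n : nat) : {pred sym} :=
  lspan [set s | exists2 l : seq V, size l = n & s = \prod_(v <- l) sgen v].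
Definition sym_plus : {pred sym} :=
  lspan [set s | exists2 n, (0 < n)%N & s \in sym_deg n].
HB.instance Definition _ n := GRing.SubmodClosed.on (sym_deg n).
HB.instance Definition _ := GRing.SubmodClosed.on sym_plus.

Lemma sym_decomp (s : sym) :
  exists c : k, exists2 u, u \in sym_plus & s = c *: (1 : sym) + u.
Proof.
elim/presAlg_ind: s => [v|c|_ _ [c [u hu ->]] [d [v hv ->]]|_ _ [c [u hu ->]] [d [v hv ->]]].
- exists 0, (sgen v); last by rewrite scale0r add0r.
  apply: mem_lspan; exists 1%N => //; apply: mem_lspan; exists [:: v] => //.
  by rewrite big_seq1.
- by exists c, 0; rewrite ?addr0 // rpred0.
- by exists (c + d), (u + v); rewrite ?rpredD // scalerDl addrACA.
have hM : u * v \in sym_plus.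
  move/lspanP: hu => hu; move/lspanP: hv => hv.
  elim: hu => [|a x x' [n n0 /lspanP hx] _ ih]; first by rewrite mul0r rpred0.
  rewrite mulrDl ualgZl rpredD ?rpredZ // {u ih x'}.
  elim: hv => [|b y y' [m m0 /lspanP hy] _ ih]; first by rewrite mulr0 rpred0.
  rewrite mulrDr ualgZr rpredD ?rpredZ // {v ih y'}.
  apply: mem_lspan; exists (n + m)%N; first by rewrite addn_gt0 n0.
  elim: hx => [|e z z' [l hl ->] _ ih]; first by rewrite mul0r rpred0.
  rewrite mulrDl ualgZl rpredD ?rpredZ // {x ih z'}.
  elim: hy => [|e' t t' [l' hl' ->] _ ih]; first by rewrite mulr0 rpred0.
  rewrite mulrDr ualgZr rpredD ?rpredZ //; apply: mem_lspan.
  by exists (l ++ l'); rewrite ?size_cat ?hl ?hl' // big_cat.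
exists (c * d), (c *: v + d *: u + u * v).
  by rewrite !rpredD ?rpredZ.
by rewrite mulrDl !mulrDr ualgZl mul1r scalerA ualgZl ualgZr mul1r mulr1 -!addrA.
Qed.

Variables (B : comUAlg k) (h : {linear V -> B}).
Lemma sym_compat x y : sym_rel x y -> interp h x = interp h y.
Proof.
by case=> {x y} /= *; rewrite ?raddfD // linearZ ualgZl mul1r.
Qed.
Definition sym_lift : algHom sym B := pres_lift sym_compat.
Lemma sym_liftE v : sym_lift (sgen v) = h v.
Proof. exact: pres_liftE. Qed.
End Symmetric.
Arguments sym_deg {k} V n.
Arguments sym_plus {k} V.

(* The direct sum of copies |V|_w of V, as finitely supported functions from
   Omega to V; [br w v] is the element v of the copy |V|_w. *)
Section Copies.
Variables (k : fieldType) (Omega : choiceType) (V : lmodType k).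

Definition copies := {malg V[Omega]}.
HB.instance Definition _ := GRing.Zmodule.on copies.

Definition br (w : Omega) (v : V) : copies := << v *g w >>.

Definition copies_scale (c : k) (g : copies) : copies :=
  [malg w in msupp g => c *: mcoeff w g].
Lemma copies_scaleE c g w : mcoeff w (copies_scale c g) = c *: mcoeff w g.
Proof.
rewrite mcoeffE; case: ifPn => // /mcoeff_outdom ->.
by rewrite scaler0.
Qed.
Lemma copies_scaleA a b v :
  copies_scale a (copies_scale b v) = copies_scale (a * b) v.
Proof. by apply/malgP=> w; rewrite !copies_scaleE scalerA. Qed.
Lemma copies_scale1 : left_id 1 copies_scale.
Proof. by move=> x; apply/malgP=> w; rewrite copies_scaleE scale1r. Qed.
Lemma copies_scaleDr : right_distributive copies_scale +%R.
Proof.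
move=> c x y; apply/malgP=> w.
by rewrite [RHS]mcoeffD !copies_scaleE mcoeffD scalerDr.
Qed.
Lemma copies_scaleDl v : {morph copies_scale^~ v : a b / a + b}.
Proof.
move=> a b; apply/malgP=> w.
by rewrite [RHS]mcoeffD !copies_scaleE scalerDl.
Qed.
HB.instance Definition _ := GRing.Zmodule_isLmodule.Build k copies
  copies_scaleA copies_scale1 copies_scaleDr copies_scaleDl.

Lemma mcoeff_copiesZ c (g : copies) w : mcoeff w (c *: g) = c *: mcoeff w g.
Proof. exact: copies_scaleE. Qed.

Lemma br_linear w : linear (br w).
Proof.
move=> c x y; apply/malgP=> w'.
by rewrite [RHS]mcoeffD mcoeff_copiesZ !mcoeffU; case: eqP; rewrite ?scaler0 ?addr0.
Qed.
HB.instance Definition _ w := GRing.isLinear.Build k V copies *:%R (br w)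
  (br_linear w).

Lemma copiesE (g : copies) : g = \sum_(w <- msupp g) br w (mcoeff w g).
Proof. exact: monalgE. Qed.

Variables (W : lmodType k) (h : Omega -> {linear V -> W}).
Definition copies_lift_fun (g : copies) : W :=
  \sum_(w <- msupp g) h w (mcoeff w g).
Lemma copies_liftEw (d : {fset Omega}) (g : copies) : (msupp g `<=` d)%fset ->
  copies_lift_fun g = \sum_(w <- d) h w (mcoeff w g).
Proof.
move=> le; rewrite [LHS](big_fset_incl _ le) => //= x xd /mcoeff_outdom ->.
by rewrite raddf0.
Qed.
Lemma copies_lift_linear : linear copies_lift_fun.
Proof.
move=> c x y.
pose d := (msupp (c *: x + y) `|` (msupp x `|` msupp y))%fset.
have hx : (msupp x `<=` d)%fset.
  by apply: fsubset_trans (fsubsetUr _ _); apply: fsubsetUl.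
have hy : (msupp y `<=` d)%fset.
  by apply: fsubset_trans (fsubsetUr _ _); apply: fsubsetUr.
rewrite (copies_liftEw (fsubsetUl _ _ : (msupp (c *: x + y) `<=` d)%fset)).
rewrite (copies_liftEw hx) (copies_liftEw hy) scaler_sumr -big_split /=.
apply: eq_bigr => w _.
by rewrite [mcoeff _ _]mcoeffD mcoeff_copiesZ linearP.
Qed.
HB.instance Definition _ := GRing.isLinear.Build k copies W *:%R
  copies_lift_fun copies_lift_linear.
Definition copies_lift : {linear copies -> W} := copies_lift_fun.
Lemma copies_liftE w v : copies_lift (br w v) = h w v.
Proof.
by rewrite /= (copies_liftEw msuppU_le) big_seq_fset1 mcoeffUU.
Qed.
End Copies.

(* k[Y], and the ideal k[Y]^+ of polynomials with zero constant term. *)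
Section Polynomials.
Variables (k : fieldType) (Y : choiceType).

Definition kY : comUAlg k := ualg_of {malg k[{cmonom Y}]}.
Definition kY_plus : {pred kY} :=
  fun p => mcoeff (@mone {cmonom Y}) (p : {malg k[{cmonom Y}]}) == 0.
Definition kX (y : Y) : kY := << (ucm y) >> : {malg k[{cmonom Y}]}.

Lemma kYZ c (p : kY) : c *: p = c *: (p : {malg k[{cmonom Y}]}) :> kY.
Proof. exact: mulr_algl. Qed.

Lemma malgUZ (c : k) (m : {cmonom Y}) :
  << c *g m >> = c *: << m >> :> {malg k[{cmonom Y}]}.
Proof. 
apply/malgP=> m'; rewrite mcoeffZ.
rewrite [LHS]mcoeffU [X in c * X]mcoeffU.
by rewrite mulr_natr. Qed.

Definition kY_const (p : kY) : k :=
  mcoeff (@mone {cmonom Y}) (p : {malg k[{cmonom Y}]}).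

Section Lift.
Variables (B : comUAlg k) (f : Y -> B).
Definition mon_eval (m : {cmonom Y}) : B := \prod_(y <- finsupp m) f y ^+ m y.
Lemma mon_evalEw (d : {fset Y}) (m : {cmonom Y}) : (finsupp m `<=` d)%fset ->
  mon_eval m = \prod_(y <- d) f y ^+ m y.
Proof.
move=> le; rewrite [LHS](big_fset_incl _ le) => //= y yd.
by rewrite -cmE_eq0 => /eqP ->.
Qed.
Lemma mon_evalM m m' : mon_eval (mmul m m') = mon_eval m * mon_eval m'.
Proof.
pose d := (finsupp m `|` finsupp m')%fset.
rewrite (@mon_evalEw d) ?mdomD // (@mon_evalEw d m) ?fsubsetUl //.
rewrite (@mon_evalEw d m') ?fsubsetUr // -big_split /=.
by apply: eq_bigr => y _; rewrite cmM exprD.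
Qed.
Lemma mon_eval1 : mon_eval mone = 1.
Proof. by rewrite /mon_eval mdom1 big_seq_fset0. Qed.
Lemma mon_evalU y : mon_eval (ucm y) = f y.
Proof. by rewrite /mon_eval mdomU big_seq_fset1 cmUU. Qed.

Definition kY_lift_fun (p : kY) : B :=
  \sum_(m <- msupp (p : {malg k[{cmonom Y}]}))
     mcoeff m (p : {malg k[{cmonom Y}]}) *: mon_eval m.
Lemma kY_liftEw (d : {fset {cmonom Y}}) (p : {malg k[{cmonom Y}]}) :
  (msupp p `<=` d)%fset ->
  kY_lift_fun p = \sum_(m <- d) mcoeff m p *: mon_eval m.
Proof.
move=> le; rewrite [LHS](big_fset_incl _ le) => //= x xd /mcoeff_outdom ->.
by rewrite scale0r.
Qed.
Lemma kY_liftU c m :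
  kY_lift_fun (<< c *g m >> : {malg k[{cmonom Y}]}) = c *: mon_eval m.
Proof. by rewrite (kY_liftEw msuppU_le) big_seq_fset1 mcoeffUU. Qed.
Lemma kY_lift_linear : linear kY_lift_fun.
Proof.
move=> c p q; pose x : {malg k[{cmonom Y}]} := p.
pose y : {malg k[{cmonom Y}]} := q.
rewrite -[p]/(x : kY) -[q]/(y : kY) kYZ.
rewrite -[in LHS]/((c *: x + y : {malg k[{cmonom Y}]}) : kY).
pose d := (msupp (c *: x + y) `|` (msupp x `|` msupp y))%fset.
have hx : (msupp x `<=` d)%fset.
  by apply: fsubset_trans (fsubsetUr _ _); apply: fsubsetUl.
have hy : (msupp y `<=` d)%fset.
  by apply: fsubset_trans (fsubsetUr _ _); apply: fsubsetUr.
rewrite (kY_liftEw (fsubsetUl _ _ : (msupp (c *: x + y) `<=` d)%fset)).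
rewrite (kY_liftEw hx) (kY_liftEw hy) scaler_sumr -big_split /=.
apply: eq_bigr => w _.
by rewrite mcoeffD mcoeffZ scalerDl scalerA.
Qed.
HB.instance Definition _ := GRing.isLinear.Build k kY B *:%R kY_lift_fun
  kY_lift_linear.
Lemma kY_lift_mult : monoid_morphism kY_lift_fun.
Proof.
split; first by rewrite [LHS](kY_liftU 1 mone) mon_eval1 scale1r.
move=> p q; rewrite [in LHS](_ : p * q = \sum_(m <- msupp (p : {malg k[{cmonom Y}]}))
  \sum_(m' <- msupp (q : {malg k[{cmonom Y}]}))
    (<< mcoeff m p * mcoeff m' q *g (mmul m m') >> : {malg k[{cmonom Y}]}) :> kY); last first.
  exact: malgME.
rewrite linear_sum /= mulr_suml; apply: eq_bigr => m _.
rewrite linear_sum /= mulr_sumr; apply: eq_bigr => m' _.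
by rewrite kY_liftU mon_evalM ualgZl ualgZr scalerA.
Qed.
Definition kY_lift : algHom kY B := AlgHom kY_lift_linear kY_lift_mult.
Lemma kY_liftE y : kY_lift (kX y) = f y.
Proof. by rewrite [LHS]kY_liftU mon_evalU scale1r. Qed.
End Lift.

Lemma kY_mon (m : {cmonom Y}) :
  (<< m >> : {malg k[{cmonom Y}]}) = mon_eval kX m :> kY.
Proof.
pose g (m : {cmonom Y}) : kY := (<< m >> : {malg k[{cmonom Y}]}).
have gM m1 m2 : g (mmul m1 m2) = g m1 * g m2.
  by rewrite /g; apply: esym; rewrite [LHS]fgmulUU mulr1.
rewrite -[LHS]/(g m).
have [n le] := ubnP (mdeg m); elim: n m le => // n ih m le.
have [/mdeg_eq0I ->|m0] := eqVneq (mdeg m) 0%N.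
  by rewrite mon_eval1.
have [y hy] : exists y, y \in finsupp m.
  apply/fset0Pn; apply: contraNneq m0 => h0.
  by rewrite mdegE h0 big_seq_fset0.
have hm : m = mmul (ucm y) (divcm m (ucm y)).
  apply/eqP/cmP=> z; rewrite cmM divcmE cmU; case: eqP => [<-|_] /=.
    by rewrite subnKC // lt0n cmE_neq0.
  by rewrite subn0.
move: (divcm m (ucm y)) hm => m' hm.
have hm' : (mdeg m' < n)%N by move: le; rewrite hm mdegM mdegU.
have -> : g m = g (ucm y) * g m' by rewrite hm; apply: gM.
have -> : mon_eval kX m = kX y * mon_eval kX m'.
  by rewrite hm mon_evalM mon_evalU.
by congr (_ * _); apply: ih.
Qed.

Lemma kY_ext (B : comUAlg k) (f g : algHom kY B) :
  (forall y, f (kX y) = g (kX y)) -> f =1 g.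
Proof.
move=> h p.
have fE (f' : algHom kY B) m :
    f' (mon_eval kX m) = \prod_(y <- finsupp m) f' (kX y) ^+ m y.
  by rewrite rmorph_prod; apply: eq_bigr => y _; rewrite rmorphXn.
rewrite (_ : p = \sum_(m <- msupp (p : {malg k[{cmonom Y}]}))
   mcoeff m (p : {malg k[{cmonom Y}]}) *: mon_eval kX m).
  rewrite !linear_sum; apply: eq_bigr => m _.
  by rewrite 2!linearZ /= !fE; congr (_ *: _); apply: eq_bigr => y _; rewrite h.
rewrite [LHS]monalgE; apply: eq_bigr => m _.
by rewrite -kY_mon kYZ malgUZ.
Qed.

Lemma kY_lift0 (B : comUAlg k) p :
  kY_lift (fun=> 0 : B) p = kY_const p *: (1 : B).
Proof.
have me (m : {cmonom Y}) : m != mone -> mon_eval (fun=> 0 : B) m = 0.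
  move=> m1; have [y hy] : exists y, y \in finsupp m.
    apply/fset0Pn; apply: contraNneq m1 => h0; rewrite -mdeg_eq0.
    by rewrite mdegE h0 big_seq_fset0.
  rewrite /mon_eval (big_fsetD1 y hy) /= expr0n.
  by rewrite (negPf (_ : m y != 0%N)) ?cmE_neq0 // mul0r.
rewrite /= /kY_lift_fun /kY_const.
set q := (p : {malg k[{cmonom Y}]}).
have [h|h] := boolP (mone \in msupp q); last first.
  rewrite (mcoeff_outdom h) scale0r big_seq_cond big1 // => m /andP[hm _].
  by rewrite me ?scaler0 //; apply: contraNneq h => <-.
rewrite (big_fsetD1 _ h) /= mon_eval1 big_seq_cond big1 ?addr0 //.
by move=> m /andP[]; rewrite in_fsetD1 => /andP[hm _] _; rewrite me ?scaler0.
Qed.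

Lemma kY_const_sub p : p - kY_const p *: (1 : kY) \in kY_plus.
Proof.
apply/eqP; rewrite [LHS]mcoeffB kYZ mcoeffZ mcoeff1 eqxx mulr1.
exact: subrr.
Qed.
End Polynomials.
Arguments kY_plus k Y : clear implicits.

Section Functoriality.
Variables (k : fieldType) (Omega : choiceType).

Definition copies_map (V W : lmodType k) (h : {linear V -> W}) :
    {linear copies Omega V -> copies Omega W} :=
  copies_lift (fun w => @br k Omega W w \o h).
Lemma copies_map_br (V W : lmodType k) (h : {linear V -> W}) w v :
  copies_map h (br w v) = br w (h v).
Proof. exact: copies_liftE. Qed.

Definition sym_map (V W : lmodType k) (h : {linear V -> W}) :
    algHom (sym V) (sym W) :=
  sym_lift (@sgen k W \o h).
Lemma sym_map_gen (V W : lmodType k) (h : {linear V -> W}) v :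
  sym_map h (sgen v) = sgen (h v).
Proof. exact: sym_liftE. Qed.
Lemma sym_map_plus (V W : lmodType k) (h : {linear V -> W}) s :
  s \in sym_plus V -> sym_map h s \in sym_plus W.
Proof.
move=> /lspanP; elim=> [|c x y [n n0 /lspanP hx] _ ih].
  by rewrite raddf0 rpred0.
rewrite algHomP rpredD ?rpredZ // {y ih}.
apply: mem_lspan; exists n => //.
elim: hx => [|d z t [l hl ->] _ ih]; first by rewrite raddf0 rpred0.
rewrite algHomP rpredD ?rpredZ // {t ih}; apply: mem_lspan.
exists (map h l); first by rewrite size_map.
rewrite rmorph_prod big_map; apply: eq_bigr => v _.
exact: sym_map_gen.
Qed.

Lemma sym_ext (V : lmodType k) (B : comUAlg k) (f g : algHom (sym V) B) :
  (forall v, f (sgen v) = g (sgen v)) -> f =1 g.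
Proof.
move=> h; elim/presAlg_ind => [v|c|x y hx hy|x y hx hy].
- exact: h.
- by rewrite !algHom_cst.
- by rewrite 2!algHomD hx hy.
- by rewrite 2!algHomM hx hy.
Qed.

Lemma tens_ext (E F B : comUAlg k) (f g : algHom (tens E F) B) :
  (forall x, f (pt x 1) = g (pt x 1)) -> (forall y, f (pt 1 y) = g (pt 1 y)) ->
  f =1 g.
Proof.
move=> h1 h2; elim/tens_ind => [x y|x y hx hy]; last by rewrite 2!algHomD hx hy.
have -> : pt x y = pt x 1 * pt 1 y by rewrite -ptM mulr1 mul1r.
by rewrite 2!algHomM h1 h2.
Qed.

Lemma restr_subproof (X X' : comUAlg k) (S : submodClosed X)
    (S' : submodClosed X') (f : algHom X X')
    (hf : forall x, x \in S -> f x \in S') (u : subm S) : f (val u) \in S'.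
Proof. exact/hf/valP. Qed.

Section Restriction.
Variables (X X' : comUAlg k) (S : submodClosed X) (S' : submodClosed X').
Variables (f : algHom X X') (hf : forall x, x \in S -> f x \in S').
Definition restr_fun (u : subm S) : subm S' := Subm (restr_subproof hf u).
Lemma restr_linear : linear restr_fun.
Proof. by move=> c x y; apply: val_inj; rewrite /= algHomP. Qed.
HB.instance Definition _ := GRing.isLinear.Build k (subm S) (subm S') *:%R
  restr_fun restr_linear.
Definition restr : {linear subm S -> subm S'} := restr_fun.
Lemma restrE u : val (restr u) = f (val u). Proof. by []. Qed.
End Restriction.
End Functoriality.

Section Construction.
Variables (k : fieldType) (Omega : choiceType) (A : comUAlg k) (Y : choiceType).

Definition AY : comUAlg k := tens A (kY k Y).
Definition AY_plus : {pred AY} :=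
  lspan [set x | exists a, exists2 p, p \in kY_plus k Y & x = pt a p].
HB.instance Definition _ := GRing.SubmodClosed.on AY_plus.

(* A[Y] (x) S(|V|_Omega), and its submodule
   A[Y]^+ (+) (A[Y] (x) S^+(|V|_Omega)) *)
Definition nextAlg (V : lmodType k) : comUAlg k :=
  tens AY (sym (copies Omega V)).
Definition next_plus (V : lmodType k) : {pred nextAlg V} :=
  lspan ([set x | exists2 u, u \in AY_plus & x = pt u 1] `|`
        [set x | exists u, exists2 s, s \in sym_plus (copies Omega V)
                                    & x = pt u s])%classic.
Arguments next_plus V : clear implicits.
HB.instance Definition _ V := GRing.SubmodClosed.on (next_plus V).

Definition floorb (V : lmodType k) (w : Omega) : {linear V -> nextAlg V} :=
  tens_inr AY (sym (copies Omega V)) \o @sgen k _ \o br w.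
Arguments floorb {V} w.

Lemma floorE V w v : @floorb V w v = pt 1 (sgen (br w v)).
Proof. by []. Qed.

Definition next_map (V W : lmodType k) (h : {linear V -> W}) :
    algHom (nextAlg V) (nextAlg W) :=
  tens_lift (tens_inl _ _)
    (hom_comp (tens_inr _ _) (sym_map (copies_map Omega h))).
Lemma next_mapE (V W : lmodType k) (h : {linear V -> W}) u s :
  next_map h (pt u s) = pt u (sym_map (copies_map Omega h) s).
Proof. by rewrite tens_liftE /= -ptM mulr1 mul1r. Qed.
Lemma next_map_floor (V W : lmodType k) (h : {linear V -> W}) w v :
  next_map h (floorb w v) = floorb w (h v).
Proof. by rewrite !floorE next_mapE sym_map_gen copies_map_br. Qed.
Lemma next_map_plus (V W : lmodType k) (h : {linear V -> W}) x :
  x \in next_plus V -> next_map h x \in next_plus W.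
Proof.
move=> /lspanP; elim=> [|c y z hy _ ih]; first by rewrite raddf0 rpred0.
rewrite algHomP rpredD ?rpredZ //; apply: mem_lspan.
case: hy => [[u hu ->]|[u [s hs ->]]]; rewrite next_mapE.
  by left; exists u; rewrite ?rmorph1.
by right; exists u, (sym_map (copies_map Omega h) s) => //; apply: sym_map_plus.
Qed.

Record stage := Stage { st_alg : comUAlg k; st_plus : submodClosed st_alg }.

Fixpoint stg (n : nat) : stage :=
  match n with
  | 0 => @Stage AY AY_plus
  | n.+1 => let V := subm (st_plus (stg n)) in @Stage (nextAlg V) (next_plus V)
  end.

Definition I_ (n : nat) : comUAlg k := st_alg (stg n).
Definition Iplus_ (n : nat) : submodClosed (I_ n) := st_plus (stg n).

Lemma inc0_plus x : x \in Iplus_ 0 ->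
  (tens_inl AY (sym (copies Omega (subm (Iplus_ 0)))) x : I_ 1) \in Iplus_ 1.
Proof. by move=> hx; apply: mem_lspan; left; exists x. Qed.

(* The natural inclusions: x |-> x (x) 1 from I_0 to I_1, and then
   id (x) S(|i|_Omega) for i the restriction of the previous one to I_n^+; they
   are injective ([inc_inj]). *)
Fixpoint inc_sig (n : nat) :
    {f : algHom (I_ n) (I_ n.+1) |
       forall x, x \in Iplus_ n -> f x \in Iplus_ n.+1} :=
  match n with
  | 0 => exist _ (tens_inl _ _ : algHom (I_ 0) (I_ 1)) inc0_plus
  | n.+1 =>
    let h := restr (proj2_sig (inc_sig n)) in
    exist _ (next_map h : algHom (I_ n.+1) (I_ n.+2)) (@next_map_plus _ _ h)
  end.
Definition inc n : algHom (I_ n) (I_ n.+1) := proj1_sig (inc_sig n).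
Lemma inc_plus n x : x \in Iplus_ n -> inc n x \in Iplus_ n.+1.
Proof. exact: (proj2_sig (inc_sig n)). Qed.

Definition bracket n (w : Omega) : {linear subm (Iplus_ n) -> I_ n.+1} :=
  floorb w.
Arguments bracket : clear implicits.
Lemma inc_bracket n w (u : subm (Iplus_ n)) (v : subm (Iplus_ n.+1)) :
  val v = inc n (val u) -> inc n.+1 (bracket n w u) = bracket n.+1 w v.
Proof.
move=> h; rewrite [LHS]next_map_floor; congr (floorb w _).
by apply: val_inj; rewrite /= h.
Qed.
Lemma bracket_plus n w u : bracket n w u \in Iplus_ n.+1.
Proof.
apply: mem_lspan; right; exists 1, (sgen (br w u)) => //.
apply: mem_lspan; exists 1%N => //; apply: mem_lspan.
by exists [:: br w u] => //; rewrite big_seq1.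
Qed.

Definition ofAY n : algHom AY (I_ n) :=
  match n with 0 => hom_id AY | n.+1 => tens_inl _ _ end.
Lemma inc_ofAY n x : inc n (ofAY n x) = ofAY n.+1 x.
Proof. by case: n => [|n] //; rewrite [LHS]next_mapE rmorph1. Qed.

Definition ofA n : algHom A (I_ n) := hom_comp (ofAY n) (tens_inl A (kY k Y)).
Lemma inc_ofA n x : inc n (ofA n x) = ofA n.+1 x.
Proof. exact: inc_ofAY. Qed.

Section Ext.
Variable (B : comUAlg k).
Lemma AY_ext (f g : algHom AY B) : (forall a, f (pt a 1) = g (pt a 1)) ->
  (forall y, f (pt 1 (kX k y)) = g (pt 1 (kX k y))) -> f =1 g.
Proof.
move=> h1 h2; apply: tens_ext => // p.
exact: (@kY_ext _ _ _ (hom_comp f (tens_inr _ _)) (hom_comp g (tens_inr _ _)) h2).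
Qed.
Lemma next_ext (V : lmodType k) (f g : algHom (nextAlg V) B) :
  (forall u, f (pt u 1) = g (pt u 1)) ->
  (forall w v, f (floorb w v) = g (floorb w v)) -> f =1 g.
Proof.
move=> h1 h2; apply: tens_ext => // s.
apply: (@sym_ext _ _ _ (hom_comp f (tens_inr _ _)) (hom_comp g (tens_inr _ _))) => x.
rewrite (copiesE x) !linear_sum; apply: eq_bigr => w _; exact: h2.
Qed.

Definition AY_lift (j : algHom A B) (f : Y -> B) : algHom AY B :=
  tens_lift j (kY_lift f).
Definition next_lift (V : lmodType k) (j : algHom AY B)
    (h : Omega -> {linear V -> B}) : algHom (nextAlg V) B :=
  tens_lift j (sym_lift (copies_lift h)).
Lemma next_liftE1 (V : lmodType k) j
    (h : Omega -> {linear V -> B}) u :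
  @next_lift V j h (pt u 1) = j u.
Proof. by rewrite tens_liftE rmorph1 mulr1. Qed.
Lemma next_lift_floor (V : lmodType k) j
    (h : Omega -> {linear V -> B}) w v :
  @next_lift V j h (floorb w v) = h w v.
Proof. by rewrite tens_liftE rmorph1 mul1r sym_liftE copies_liftE. Qed.
End Ext.

(* The projection of I_n = A (+) I_n^+ onto A; see [I_decomp], [aug_plus] and
   [aug_ofA] for the decomposition. *)
Definition aug0 : algHom AY A := AY_lift (hom_id A) (fun=> 0).
Definition aug1 (V : lmodType k) : algHom (nextAlg V) A :=
  next_lift aug0 (fun=> \0).
Definition aug n : algHom (I_ n) A :=
  match n with
  | 0 => aug0
  | n.+1 => @aug1 _
  end.

Lemma aug_ofA n a : aug n (ofA n a) = a.
Proof.
have h : aug0 (pt a 1) = a by rewrite tens_liftE rmorph1 mulr1.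
by case: n => [|n] //; rewrite [LHS]next_liftE1.
Qed.

Lemma AY_decomp x : x - pt (aug0 x) 1 \in AY_plus.
Proof.
elim/tens_ind: x => [a p|x y hx hy]; last first.
  by rewrite algHomD ptDl opprD addrACA rpredD.
have -> : pt (aug0 (pt a p)) 1 = pt a (kY_const p *: (1 : kY k Y)).
  by rewrite tens_liftE kY_lift0 ualgZr mulr1 ptZl ptZr.
rewrite -[- pt _ _]scaleN1r -ptZr -ptDr scaleN1r.
apply: mem_lspan; exists a, (p - kY_const p *: (1 : kY k Y)) => //.
exact: kY_const_sub.
Qed.

Lemma sym_lift0 (B : comUAlg k) (V : lmodType k) s :
  s \in sym_plus (copies Omega V) ->
  sym_lift (copies_lift (fun=> \0 : {linear V -> B})) s = 0.
Proof.
move/lspanP; elim=> {s} [|d x y [n n0 /lspanP hx] _ ih].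
  by rewrite raddf0.
rewrite algHomP ih addr0; case: n n0 hx => // n _ hx.
rewrite (_ : sym_lift _ x = 0) ?scaler0 //.
elim: hx => [|e z t [[|v l] // _ ->] _ ht]; first by rewrite raddf0.
rewrite algHomP ht addr0 big_cons algHomM sym_liftE.
rewrite (_ : copies_lift _ v = 0) ?mul0r ?scaler0 //.
by rewrite /= /copies_lift_fun big1.
Qed.

Lemma next_decomp (V : lmodType k) (x : nextAlg V) :
  x - pt (pt (@aug1 V x) 1) 1 \in next_plus V.
Proof.
elim/tens_ind: x => [p s|x y hx hy]; last first.
  by rewrite algHomD !ptDl opprD addrACA rpredD.
have [c [u hu ->]] := sym_decomp s.
have -> : @aug1 V (pt p (c *: (1 : sym (copies Omega V)) + u)) = c *: aug0 p.
  by rewrite tens_liftE algHomD algHom_cst sym_lift0 // addr0 ualgZr mulr1.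
rewrite ptDr ptZr -ptZl -addrA [pt p u + _]addrC addrA rpredD //; last first.
  by apply: mem_lspan; right; exists p, u.
rewrite -[- pt _ _]scaleN1r -ptZl -ptDl scaleN1r; apply: mem_lspan; left.
eexists; last by [].
by rewrite ptZl -scalerBr rpredZ // AY_decomp.
Qed.

Lemma I_decomp n x : x - ofA n (aug n x) \in Iplus_ n.
Proof. by case: n x => [|n] x; [apply: AY_decomp | apply: next_decomp]. Qed.

Lemma inc_aug n x : aug n.+1 (inc n x) = aug n x.
Proof.
case: n x => [|n] x; first exact: next_liftE1.
move: x; apply: (next_ext (f := hom_comp (aug n.+2) (inc n.+1)) (g := aug n.+1)).
  move=> u; transitivity (aug n.+2 (ofAY n.+2 u)).
    by congr (aug _ _); exact: (inc_ofAY n.+1 u).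
  by rewrite [LHS]next_liftE1 [RHS]next_liftE1.
move=> w v.
transitivity (aug n.+2 (bracket n.+1 w (restr (@inc_plus n) v))).
  by congr (aug _ _); exact: inc_bracket.
by rewrite [LHS]next_lift_floor [RHS]next_lift_floor.
Qed.

Lemma aug0_plus x : x \in AY_plus -> aug0 x = 0.
Proof.
move=> /lspanP; elim=> [|c y z [a [p hp ->]] _ ih]; first by rewrite raddf0.
rewrite algHomP ih addr0 tens_liftE kY_lift0.
by move: hp => /eqP; rewrite -[mcoeff _ _]/(kY_const p) => ->; rewrite scale0r mulr0 scaler0.
Qed.

Lemma aug1_plus (V : lmodType k) (x : nextAlg V) :
  x \in next_plus V -> @aug1 V x = 0.
Proof.
move=> /lspanP; elim=> [|c y z hy _ ih]; first by rewrite raddf0.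
rewrite algHomP ih addr0; case: hy => [[u hu ->]|[u [s hs ->]]].
  by rewrite next_liftE1 aug0_plus ?scaler0.
by rewrite tens_liftE sym_lift0 // mulr0 scaler0.
Qed.
Lemma aug_plus n x : x \in Iplus_ n -> aug n x = 0.
Proof. by case: n x => [|n] x; [apply: aug0_plus | apply: aug1_plus]. Qed.

Lemma next_map_cancel (V W : lmodType k) (f : {linear V -> W})
    (g : {linear W -> V}) : cancel f g -> cancel (next_map f) (next_map g).
Proof.
move=> fK; apply: (next_ext (f := hom_comp (next_map g) (next_map f))
  (g := hom_id (nextAlg V))) => [u|w v].
  transitivity (next_map g (pt u 1)).
    by congr (next_map g _); rewrite next_mapE rmorph1.
  by rewrite next_mapE rmorph1.
transitivity (next_map g (floorb w (f v))).
  by congr (next_map g _); rewrite next_map_floor.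
by rewrite next_map_floor fK.
Qed.

Lemma inc_retract n : exists r : algHom (I_ n.+1) (I_ n),
  (forall x, x \in Iplus_ n.+1 -> r x \in Iplus_ n) /\ cancel (inc n) r.
Proof.
elim: n => [|n [r [hp hr]]].
  exists (next_lift (hom_id AY) (fun=> \0)); split; last first.
    by move=> x; rewrite [LHS]next_liftE1.
  move=> x /lspanP; elim=> [|c y z hy _ ih]; first by rewrite raddf0 rpred0.
  rewrite algHomP rpredD ?rpredZ //; case: hy => [[u hu ->]|[u [s hs ->]]].
    by rewrite next_liftE1.
  by rewrite tens_liftE sym_lift0 // mulr0 rpred0.
exists (next_map (restr hp)); split; first exact: next_map_plus.
by move=> x; apply: next_map_cancel => u; apply: val_inj; rewrite /= hr.
Qed.

Lemma inc_inj n : injective (inc n).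
Proof. by have [r [_ hr]] := inc_retract n; apply: can_inj hr. Qed.

(* The union of the I_n along the inclusions [inc]: classes of pairs (n, x)
   with x in I_n, two pairs being identified when they become equal at all
   large enough stages. [up x p] is the image of x in I_p for p >= n. *)
Fixpoint up (n : nat) (x : I_ n) (p : nat) {struct p} : I_ p :=
  if @eqP _ n p is ReflectT e then ecast m (I_ m) e x
  else match p return I_ p with 0 => 0 | p'.+1 => inc p' (up x p') end.

Lemma up_id n (x : I_ n) : up x n = x.
Proof. by case: n x => [|n] x /=; case: eqP => // e; rewrite eq_axiomK. Qed.

Lemma upS n (x : I_ n) p : (n <= p)%N -> up x p.+1 = inc p (up x p).
Proof.
move=> le /=; case: eqP => // e.
by move: le; rewrite [in X in X -> _]e ltnn.
Qed.

Lemma up_hom n p : (n <= p)%N ->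
  exists f : algHom (I_ n) (I_ p), forall x, up x p = f x.
Proof.
elim: p => [|p ih].
  by rewrite leqn0 => /eqP ->; exists (hom_id _) => x; rewrite up_id.
rewrite leq_eqVlt => /orP[/eqP -> | le].
  by exists (hom_id _) => x; rewrite up_id.
have [f hf] := ih le; exists (hom_comp (inc p) f) => x.
by rewrite upS // hf.
Qed.

Lemma up_up n m p (x : I_ n) : (n <= m)%N -> (m <= p)%N ->
  up (up x m) p = up x p.
Proof.
move=> nm; elim: p => [|p ih].
  by rewrite leqn0 => /eqP e; subst m; rewrite up_id.
rewrite leq_eqVlt => /orP[/eqP e | le]; first by subst m; rewrite up_id.
by rewrite upS // ih // upS //; apply: leq_trans nm le.
Qed.

Definition preU := {n : nat & I_ n}.
HB.instance Definition _ := gen_eqMixin preU.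
HB.instance Definition _ := gen_choiceMixin preU.
Implicit Types u v : preU.

Definition mkU n (x : I_ n) : preU := Tagged I_ x.
Definition img u p : I_ p := up (tagged u) p.

Definition u_eq u v := exists N, forall p, (N <= p)%N -> img u p = img v p.
Definition u_eqb : rel preU := fun u v => `[< u_eq u v >].
Lemma u_eqb_refl : reflexive u_eqb.
Proof. by move=> u; apply/asboolP; exists 0%N. Qed.
Lemma u_eqb_sym : symmetric u_eqb.
Proof.
by move=> u v; apply: asbool_equiv_eq; split=> -[N h]; exists N => p /h.
Qed.
Lemma u_eqb_trans : transitive u_eqb.
Proof.
move=> v u w /asboolP [N h] /asboolP [N' h']; apply/asboolP.
by exists (maxn N N') => p; rewrite geq_max => /andP[/h -> /h' ->].
Qed.
Canonical u_equiv := EquivRel u_eqb u_eqb_refl u_eqb_sym u_eqb_trans.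

Definition U_sort := {eq_quot u_equiv}.
HB.instance Definition _ := Choice.on U_sort.
Definition ucl u : U_sort := \pi_({eq_quot u_equiv}) u.
Lemma uclP u v : ucl u = ucl v <-> u_eq u v.
Proof. by split=> [/eqmodP/asboolP|h] //; apply/eqmodP/asboolP. Qed.
Definition urepr (x : U_sort) : preU := repr (x : {eq_quot u_equiv}).
Lemma ureprK x : ucl (urepr x) = x.
Proof. exact: reprK. Qed.

Definition u_max u v := maxn (tag u) (tag v).
Definition u_add u v := mkU (img u (u_max u v) + img v (u_max u v)).
Definition u_mul u v := mkU (img u (u_max u v) * img v (u_max u v)).
Definition u_opp u := mkU (- tagged u).
Definition u_cst (c : k) : preU := mkU (c *: (1 : I_ 0)).

Lemma img_add u v p : (u_max u v <= p)%N ->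
  img (u_add u v) p = img u p + img v p.
Proof.
move=> h; have [f hf] := up_hom h.
rewrite /img hf algHomD -!hf !up_up // ?leq_maxl ?leq_maxr //.
Qed.
Lemma img_mul u v p : (u_max u v <= p)%N ->
  img (u_mul u v) p = img u p * img v p.
Proof.
move=> h; have [f hf] := up_hom h.
rewrite /img hf algHomM -!hf !up_up // ?leq_maxl ?leq_maxr //.
Qed.
Lemma img_opp u p : (tag u <= p)%N -> img (u_opp u) p = - img u p.
Proof. by move=> h; have [f hf] := up_hom h; rewrite /img !hf /= raddfN. Qed.
Lemma img_cst c p : img (u_cst c) p = c *: (1 : I_ p).
Proof. by have [f hf] := up_hom (leq0n p); rewrite /img hf algHom_cst. Qed.

Definition U_add (x y : U_sort) := ucl (u_add (urepr x) (urepr y)).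
Definition U_mul (x y : U_sort) := ucl (u_mul (urepr x) (urepr y)).
Definition U_opp (x : U_sort) := ucl (u_opp (urepr x)).
Definition U_cst c := ucl (u_cst c).

Lemma urepr_img u :
  exists N, forall p, (N <= p)%N -> img (urepr (ucl u)) p = img u p.
Proof. by apply/uclP; rewrite ureprK. Qed.

(* g p is the image in I_p of a representative of x, for all large p. *)
Definition tracks (x : U_sort) (g : forall p, I_ p) :=
  exists N, forall p, (N <= p)%N -> img (urepr x) p = g p.
Lemma tracks_eq x y g : tracks x g -> tracks y g -> x = y.
Proof.
move=> [N h] [N' h']; rewrite -[x]ureprK -[y]ureprK; apply/uclP.
by exists (maxn N N') => p; rewrite geq_max => /andP[/h -> /h' ->].
Qed.
Lemma tracks_self x : tracks x (img (urepr x)).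
Proof. by exists 0%N. Qed.
Lemma tracks_cl u : tracks (ucl u) (img u).
Proof. exact: urepr_img. Qed.
Lemma tracks_add x y g h : tracks x g -> tracks y h ->
  tracks (U_add x y) (fun p => g p + h p).
Proof.
move=> [N hx] [N' hy]; have [M hM] := urepr_img (u_add (urepr x) (urepr y)).
exists (maxn (maxn M (u_max (urepr x) (urepr y))) (maxn N N')) => p.
rewrite !geq_max => /andP[/andP[/hM -> hm] /andP[/hx <- /hy <-]].
by rewrite img_add // /u_max geq_max.
Qed.
Lemma tracks_mul x y g h : tracks x g -> tracks y h ->
  tracks (U_mul x y) (fun p => g p * h p).
Proof.
move=> [N hx] [N' hy]; have [M hM] := urepr_img (u_mul (urepr x) (urepr y)).
exists (maxn (maxn M (u_max (urepr x) (urepr y))) (maxn N N')) => p.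
rewrite !geq_max => /andP[/andP[/hM -> hm] /andP[/hx <- /hy <-]].
by rewrite img_mul // /u_max geq_max.
Qed.
Lemma tracks_opp x g : tracks x g -> tracks (U_opp x) (fun p => - g p).
Proof.
move=> [N hx]; have [M hM] := urepr_img (u_opp (urepr x)).
exists (maxn (maxn M (tag (urepr x))) N) => p.
by rewrite !geq_max => /andP[/andP[/hM -> hm] /hx <-]; rewrite img_opp.
Qed.
Lemma tracks_cst c : tracks (U_cst c) (fun p => c *: (1 : I_ p)).
Proof.
by have [N h] := tracks_cl (u_cst c); exists N => p /h ->; rewrite img_cst.
Qed.
Lemma tracks_ext x g h : (forall p, g p = h p) -> tracks x g -> tracks x h.
Proof. by move=> e [N H]; exists N => p /H ->. Qed.

Let ts := tracks_self.
Lemma U_addA : associative U_add.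
Proof.
move=> x y z.
apply: tracks_eq (tracks_add (ts x) (tracks_add (ts y) (ts z))) _.
apply: tracks_ext (tracks_add (tracks_add (ts x) (ts y)) (ts z)) => p.
by rewrite addrA.
Qed.
Lemma U_addC : commutative U_add.
Proof.
move=> x y; apply: tracks_eq (tracks_add (ts x) (ts y)) _.
by apply: tracks_ext (tracks_add (ts y) (ts x)) => p; rewrite addrC.
Qed.
Lemma U_add0 : left_id (U_cst 0) U_add.
Proof.
move=> x; apply: tracks_eq (tracks_add (tracks_cst 0) (ts x)) _.
by apply: tracks_ext (ts x) => p; rewrite scale0r add0r.
Qed.
Lemma U_addN : left_inverse (U_cst 0) U_opp U_add.
Proof.
move=> x; apply: tracks_eq (tracks_add (tracks_opp (ts x)) (ts x)) _.
by apply: tracks_ext (tracks_cst 0) => p; rewrite scale0r addNr.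
Qed.
Lemma U_mulA : associative U_mul.
Proof.
move=> x y z.
apply: tracks_eq (tracks_mul (ts x) (tracks_mul (ts y) (ts z))) _.
apply: tracks_ext (tracks_mul (tracks_mul (ts x) (ts y)) (ts z)) => p.
by rewrite mulrA.
Qed.
Lemma U_mulC : commutative U_mul.
Proof.
move=> x y; apply: tracks_eq (tracks_mul (ts x) (ts y)) _.
by apply: tracks_ext (tracks_mul (ts y) (ts x)) => p; rewrite mulrC.
Qed.
Lemma U_mul1 : left_id (U_cst 1) U_mul.
Proof.
move=> x; apply: tracks_eq (tracks_mul (tracks_cst 1) (ts x)) _.
by apply: tracks_ext (ts x) => p; rewrite scale1r mul1r.
Qed.
Lemma U_mulD : left_distributive U_mul U_add.
Proof.
move=> x y z; apply: tracks_eq (tracks_mul (tracks_add (ts x) (ts y)) (ts z)) _.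
apply: tracks_ext (tracks_add (tracks_mul (ts x) (ts z))
  (tracks_mul (ts y) (ts z))) => p.
by rewrite mulrDl.
Qed.
HB.instance Definition _ := GRing.isZmodule.Build U_sort
  U_addA U_addC U_add0 U_addN.
HB.instance Definition _ := GRing.Zmodule_isComPzRing.Build U_sort
  U_mulA U_mulC U_mul1 U_mulD.

Lemma U_cstD (a b : k) : U_cst (a + b) = U_cst a + U_cst b.
Proof.
apply: tracks_eq (tracks_cst _) _.
apply: tracks_ext (tracks_add (tracks_cst a) (tracks_cst b)) => p.
by rewrite scalerDl.
Qed.
Lemma U_cst_additive : zmod_morphism U_cst.
Proof. by move=> a b; rewrite -[in RHS](subrK b a) [in RHS]U_cstD addrK. Qed.
Lemma U_cst_mult : monoid_morphism U_cst.
Proof.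
split=> // a b; apply: tracks_eq (tracks_cst _) _.
apply: tracks_ext (tracks_mul (tracks_cst a) (tracks_cst b)) => p.
by rewrite ualgZl mul1r scalerA.
Qed.
HB.instance Definition _ := GRing.isZmodMorphism.Build k U_sort
  U_cst U_cst_additive.
HB.instance Definition _ := GRing.isMonoidMorphism.Build k U_sort
  U_cst U_cst_mult.

Definition freeU : comUAlg k := @ComUAlg k U_sort U_cst.

Definition ofI_fun n (x : I_ n) : freeU := ucl (mkU x).
Lemma tracks_ofI n x : tracks (@ofI_fun n x) (fun p => up x p).
Proof. exact: tracks_cl. Qed.
Lemma tracks_late x N g h : (forall p, (N <= p)%N -> g p = h p) ->
  tracks x g -> tracks x h.
Proof.
move=> e [M H]; exists (maxn N M) => p.
by rewrite geq_max => /andP[/e <- /H].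
Qed.
Lemma ofI_linear n : linear (@ofI_fun n).
Proof.
move=> c x y; apply: tracks_eq (tracks_ofI _) _.
apply: (tracks_late (N := n)) (tracks_add (tracks_mul (tracks_cst c)
  (tracks_ofI x)) (tracks_ofI y)) => p /up_hom [f hf].
by rewrite !hf algHomP ualgZl mul1r.
Qed.
Lemma ofI_mult n : monoid_morphism (@ofI_fun n).
Proof.
split=> [|x y]; apply: tracks_eq (tracks_ofI _) _.
  apply: (tracks_late (N := n)) (tracks_cst 1) => p /up_hom [f hf].
  by rewrite hf rmorph1 scale1r.
apply: (tracks_late (N := n)) (tracks_mul (tracks_ofI x) (tracks_ofI y)).
by move=> p /up_hom [f hf]; rewrite !hf algHomM.
Qed.
Definition ofI n : algHom (I_ n) freeU := AlgHom (@ofI_linear n) (@ofI_mult n).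

Lemma ofI_inc n x : ofI n.+1 (inc n x) = ofI n x.
Proof.
apply: tracks_eq (tracks_ofI _) _.
apply: (tracks_late (N := n.+1)) (tracks_ofI x) => p le.
have <- : up x n.+1 = inc n x by rewrite upS // up_id.
by rewrite up_up.
Qed.
Lemma ofI_up n p x : (n <= p)%N -> ofI p (up x p) = ofI n x.
Proof.
elim: p => [|p ih].
  by rewrite leqn0 => /eqP e; subst n; rewrite up_id.
rewrite leq_eqVlt => /orP[/eqP e | le]; first by subst n; rewrite up_id.
by rewrite upS // ofI_inc ih.
Qed.
Lemma UP (x : freeU) : exists n y, x = ofI n y.
Proof.
exists (tag (urepr x)), (tagged (urepr x)).
by rewrite -[LHS]ureprK [LHS]/(ucl _); case: (urepr x).
Qed.
Lemma UP2 (x y : freeU) : exists n a b, x = ofI n a /\ y = ofI n b.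
Proof.
have [n [a ->]] := UP x; have [m [b ->]] := UP y.
exists (maxn n m), (up a _), (up b _).
by rewrite !ofI_up ?leq_maxl ?leq_maxr.
Qed.

Section UnionLift.
Variables (T : Type) (g : forall n, I_ n -> T).
Hypothesis hg : forall n x, g (inc n x) = g x.
Definition U_lift_fun (x : freeU) : T := g (tagged (urepr x)).
Lemma g_up n p (x : I_ n) : (n <= p)%N -> g (up x p) = g x.
Proof.
elim: p => [|p ih].
  by rewrite leqn0 => /eqP e; subst n; rewrite up_id.
rewrite leq_eqVlt => /orP[/eqP e | le]; first by subst n; rewrite up_id.
by rewrite upS // hg ih.
Qed.
Lemma U_lift_funE n x : U_lift_fun (ofI n x) = g x.
Proof.
have [N h] := urepr_img (mkU x).
rewrite /U_lift_fun -[RHS](@g_up _ (maxn N (maxn n (tag (urepr (ofI n x)))))).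
  rewrite -[LHS](@g_up _ (maxn N (maxn n (tag (urepr (ofI n x)))))).
    by congr (g _); apply: h; apply: leq_maxl.
  by apply: leq_trans (leq_maxr _ _); apply: leq_maxr.
by apply: leq_trans (leq_maxr _ _); apply: leq_maxl.
Qed.
End UnionLift.

Definition freeU_plus : set freeU :=
  [set x | exists n, exists2 y, y \in Iplus_ n & x = ofI n y]%classic.

Definition ofA_U : algHom A freeU := hom_comp (ofI 0) (ofA 0).
Lemma ofA_UE n a : ofI n (ofA n a) = ofA_U a.
Proof. by elim: n => // n <-; rewrite -inc_ofA ofI_inc. Qed.
Definition freeX (y : Y) : freeU := ofI 0 (pt 1 (kX k y) : AY).
Lemma XE n y : ofI n (ofAY n (pt 1 (kX k y))) = freeX y.
Proof. by elim: n => // n <-; rewrite -inc_ofAY ofI_inc. Qed.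
End Construction.
Arguments bracket {k Omega A Y} n w.

Record opAlg (k : fieldType) (Omega : choiceType) := OpAlg {
  op_alg :> comUAlg k;
  op : Omega -> {linear op_alg -> op_alg}
}.
Arguments op {k Omega} o w : rename.

Definition op_hom (k : fieldType) (Omega : choiceType) (R S : opAlg k Omega)
    (f : algHom R S) : Prop :=
  forall w x, f (op R w x) = op S w (f x).

Record opAlgOver (k : fieldType) (Omega : choiceType) (A : opAlg k Omega) :=
  OpAlgOver {
    over_alg :> opAlg k Omega;
    over_struct : algHom A over_alg;
    over_struct_op : op_hom over_struct
  }.

Definition over_hom (k : fieldType) (Omega : choiceType) (A : opAlg k Omega)
    (R S : opAlgOver A) (f : algHom R S) : Prop :=
  op_hom f /\ forall a, f (over_struct R a) = over_struct S a.

Section FreeOperated.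
Variables (k : fieldType) (Omega : choiceType) (A : opAlg k Omega).
Variable (Y : choiceType).

Local Notation I_ n := (I_ Omega A Y n).
Local Notation Iplus_ n := (Iplus_ Omega A Y n).
Local Notation freeU := (freeU Omega A Y).
Local Notation inc n := (inc Omega A Y n).
Local Notation ofI n := (ofI Omega A Y n).
Local Notation ofA n := (ofA Omega A Y n).
Local Notation aug n := (aug Omega A Y n).

(* Pi_w is rho_w on A and |_|_w on I_n^+, hence sends x = a + u to
   rho_w(a) + |u|_w; see [Pi_A] and [Pi_plus]. *)
Definition plus_part n (x : I_ n) : subm (Iplus_ n) := Subm (I_decomp x).
Definition Pi_stage n (w : Omega) (x : I_ n) : I_ n.+1 :=
  ofA n.+1 (op A w (aug n x)) + bracket _ w (plus_part x).

Lemma plus_part_linear n : linear (@plus_part n).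
Proof.
move=> c x y; apply: val_inj.
rewrite -[RHS]/(c *: (x - ofA n (aug n x)) + (y - ofA n (aug n y))).
rewrite -[LHS]/(c *: x + y - ofA n (aug n (c *: x + y))).
by rewrite !algHomP scalerBr opprD addrACA.
Qed.
Lemma Pi_stage_linear n w : linear (@Pi_stage n w).
Proof.
move=> c x y; rewrite /Pi_stage plus_part_linear (algHomP (aug n)) [op A w _]linearP.
rewrite [bracket _ _ _]linearP (algHomP (ofA n.+1)) /=.
by rewrite scalerDr addrACA.
Qed.
Lemma inc_Pi n w x : inc n.+1 (@Pi_stage n w x) = Pi_stage w (inc n x).
Proof.
have e : val (plus_part (inc n x)) = inc n (val (plus_part x)).
  rewrite -[LHS]/(inc n x - ofA n.+1 (aug n.+1 (inc n x))).
  rewrite -[RHS]/(inc n (x - ofA n (aug n x))).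
  by rewrite algHomB inc_ofA inc_aug.
rewrite [LHS](algHomD (inc n.+1)) (inc_bracket w e) inc_ofA.
by rewrite /Pi_stage inc_aug.
Qed.

Lemma Pi_compat w n x :
  ofI n.+2 (Pi_stage w (inc n x)) = ofI n.+1 (@Pi_stage n w x).
Proof. by rewrite -inc_Pi ofI_inc. Qed.

Definition Pi_fun (w : Omega) : freeU -> freeU :=
  U_lift_fun (fun n x => ofI n.+1 (@Pi_stage n w x)).
Lemma Pi_funE w n x : Pi_fun w (ofI n x) = ofI n.+1 (@Pi_stage n w x).
Proof. exact: (U_lift_funE (@Pi_compat w)). Qed.
Lemma Pi_linear w : linear (Pi_fun w).
Proof.
move=> c x y; have [n [a [b [-> ->]]]] := UP2 x y.
by rewrite -algHomP !Pi_funE Pi_stage_linear algHomP.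
Qed.
HB.instance Definition _ w := GRing.isLinear.Build k freeU freeU *:%R (Pi_fun w)
  (Pi_linear w).
Definition Pi_op (w : Omega) : {linear freeU -> freeU} := Pi_fun w.

Lemma Pi_A w a : Pi_op w (ofA_U Omega A Y a) = ofA_U Omega A Y (op A w a).
Proof.
rewrite [LHS](@Pi_funE w 0 (ofA 0 a)) -(@ofA_UE _ _ _ _ 1) /Pi_stage aug_ofA.
rewrite (_ : plus_part _ = 0) ?raddf0 ?addr0 //.
by apply: val_inj; rewrite -[LHS]/(ofA 0 a - ofA 0 (aug 0 (ofA 0 a))) aug_ofA subrr.
Qed.
Lemma Pi_plus w n (u : subm (Iplus_ n)) :
  Pi_op w (ofI n (val u)) = ofI n.+1 (bracket _ w u).
Proof.
rewrite [LHS]Pi_funE /Pi_stage aug_plus ?(valP u) // !raddf0 add0r.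
congr (ofI _ (bracket _ _ _)); apply: val_inj.
rewrite -[LHS]/(val u - ofA n (aug n (val u))).
by rewrite aug_plus ?(valP u) // raddf0 subr0.
Qed.

Definition freeOp_alg : opAlg k Omega := @OpAlg k Omega freeU Pi_op.
Lemma freeOp_struct_op : op_hom (ofA_U Omega A Y : algHom A freeOp_alg).
Proof. by move=> w a; rewrite [RHS]Pi_A. Qed.
(* The free (A, rho_Omega)-algebra I(Omega, A[Y]). *)
Definition freeOp : opAlgOver A := OpAlgOver freeOp_struct_op.
Definition var_op (y : Y) : freeOp := freeX Omega A y.

Section Eval.
Variables (R : opAlgOver A) (f : Y -> R).

Section EvalBracket.
Variables (n : nat) (e : algHom (I_ n) R).
Definition ev_op_fun (w : Omega) (u : subm (Iplus_ n)) : R :=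
  op R w (e (val u)).
Lemma ev_op_linear w : linear (ev_op_fun w).
Proof.
move=> c x y; rewrite /ev_op_fun -linearP -algHomP.
by congr (op R w (e _)); rewrite linearP.
Qed.
HB.instance Definition _ w := GRing.isLinear.Build k (subm (Iplus_ n)) R *:%R
  (ev_op_fun w) (ev_op_linear w).
Definition ev_op w : {linear subm (Iplus_ n) -> R} := ev_op_fun w.
End EvalBracket.

Fixpoint ev_stage n : algHom (I_ n) R :=
  match n return algHom (I_ n) R with
  | 0 => AY_lift (over_struct R) f
  | n.+1 => next_lift (AY_lift (over_struct R) f)
              (ev_op (ev_stage n))
  end.
Lemma ev_AY n u : ev_stage n (ofAY Omega A Y n u) = AY_lift (over_struct R) f u.
Proof. by case: n => [|n] //; exact: next_liftE1. Qed.
Lemma ev_bracket n w u :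
  ev_stage n.+1 (bracket _ w u) = op R w (ev_stage n (val u)).
Proof. exact: next_lift_floor. Qed.
Lemma ev_inc n x : ev_stage n.+1 (inc n x) = ev_stage n x.
Proof.
elim: n x => [|n ih] x; first exact: next_liftE1.
move: x.
apply: (next_ext (f := hom_comp (ev_stage n.+2) (inc n.+1)) (g := ev_stage n.+1)).
  move=> u; transitivity (ev_stage n.+2 (ofAY Omega A Y n.+2 u)).
    by congr (ev_stage _ _); exact: (@inc_ofAY _ _ _ _ n.+1 u).
  by rewrite ev_AY [RHS]next_liftE1.
move=> w v.
transitivity (ev_stage n.+2 (bracket _ w (restr (@inc_plus _ _ _ _ n) v))).
  by congr (ev_stage _ _); exact: inc_bracket.
rewrite ev_bracket -[RHS]/(ev_stage n.+1 (bracket _ w v)) ev_bracket.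
by congr (op R w _); exact: ih.
Qed.

Definition ev_fun : freeOp -> R := U_lift_fun (fun n => ev_stage n).
Lemma ev_funE n x : ev_fun (ofI n x) = ev_stage n x.
Proof. exact: (U_lift_funE ev_inc). Qed.
Lemma ev_linear : linear ev_fun.
Proof.
move=> c x y; have [n [a [b [-> ->]]]] := UP2 x y.
by rewrite -algHomP !ev_funE algHomP.
Qed.
Lemma ev_mult : monoid_morphism ev_fun.
Proof.
split=> [|x y]; first by rewrite -(rmorph1 (ofI 0)) ev_funE rmorph1.
have [n [a [b [-> ->]]]] := UP2 x y.
by rewrite -algHomM !ev_funE algHomM.
Qed.
Definition eval_hom : algHom freeOp R := AlgHom ev_linear ev_mult.

Lemma ev_ofA n a : ev_stage n (ofA n a) = over_struct R a.
Proof. by rewrite ev_AY tens_liftE rmorph1 mulr1. Qed.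

Lemma ev_hom : over_hom eval_hom.
Proof.
split=> [w x|a]; last by rewrite [LHS]ev_funE ev_ofA.
have [n [a ->]] := UP x.
rewrite [X in eval_hom X]Pi_funE [LHS]ev_funE [eval_hom _]ev_funE.
rewrite /Pi_stage algHomD ev_ofA ev_bracket over_struct_op.
rewrite -[val (plus_part a)]/(a - ofA n (aug n a)) algHomB linearB /= ev_ofA.
by rewrite addrC subrK.
Qed.
Lemma ev_var y : eval_hom (var_op y) = f y.
Proof. by rewrite [LHS]ev_funE [LHS]tens_liftE rmorph1 mul1r kY_liftE. Qed.

Lemma ev_unique (g : algHom freeOp R) :
  over_hom g -> (forall y, g (var_op y) = f y) -> g =1 eval_hom.
Proof.
move=> [gop gA] gY x; have [n [a ->]] := UP x; rewrite [RHS]ev_funE {x}.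
have hAY n' : (hom_comp g (hom_comp (ofI n') (ofAY Omega A Y n')))
    =1 AY_lift (over_struct R) f.
  apply: AY_ext => [b|y].
    transitivity (g (ofI n' (ofA n' b))); first by [].
    by rewrite ofA_UE [LHS]gA tens_liftE rmorph1 mulr1.
  transitivity (g (ofI n' (ofAY Omega A Y n' (pt 1 (kX k y))))); first by [].
  by rewrite XE [LHS]gY tens_liftE rmorph1 mul1r kY_liftE.
elim: n a => [|n ih]; first exact: (hAY 0).
apply: (next_ext (f := hom_comp g (ofI n.+1)) (g := ev_stage n.+1)) => [u|w v].
  by rewrite [LHS](hAY n.+1) [RHS]next_liftE1.
transitivity (g (Pi_op w (ofI n (val v)))); first by rewrite Pi_plus.
by rewrite [LHS]gop ih -ev_bracket.
Qed.
End Eval.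
End FreeOperated.
Arguments freeOp {k Omega} A Y.
Arguments var_op {k Omega} A {Y} y.

Lemma freeOp_universal (k : fieldType) (Omega : choiceType)
    (A : opAlg k Omega) (Y : choiceType) (R : opAlgOver A) (f : Y -> R) :
  exists g : algHom (freeOp A Y) R,
    [/\ over_hom g, forall y, g (var_op A y) = f y
      & forall g' : algHom (freeOp A Y) R,
          over_hom g' -> (forall y, g' (var_op A y) = f y) -> g' =1 g].
Proof.
by exists (eval_hom f); split; [exact: ev_hom | exact: ev_var | exact: ev_unique].
Qed.

Lemma id_op (k : fieldType) (Omega : choiceType) (A : opAlg k Omega) :
  op_hom (hom_id A).
Proof. by []. Qed.
Definition self_over (k : fieldType) (Omega : choiceType) (A : opAlg k Omega) :
  opAlgOver A := OpAlgOver (@id_op k Omega A).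

Section Equations.
Variables (k : fieldType) (Omega : choiceType) (A : opAlg k Omega).
Variable (Y : choiceType).

Definition eval_map (f : Y -> A) : algHom (freeOp A Y) A :=
  eval_hom (f : Y -> self_over A).

Definition is_solution (f : Y -> A) (phi : freeOp A Y) : Prop :=
  eval_map f phi = 0.

Definition solution_set (phi : freeOp A Y) : set (Y -> A) :=
  [set f | is_solution f phi]%classic.

Definition J_rho_f (f : Y -> A) : set (freeOp A Y) :=
  [set phi | eval_map f phi = 0]%classic.

Definition J_rho : set (freeOp A Y) :=
  (\bigcap_(f in [set: Y -> A]) J_rho_f f)%classic.
End Equations.
Arguments J_rho_f {k Omega A Y} f.
Arguments J_rho {k Omega} A Y.

(* Main.v *)
Require Import Defs.
From mathcomp Require Import all_boot all_order all_algebra.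
From mathcomp Require Import boolp classical_sets.

Import GRing.Theory.
Local Open Scope ring_scope.

(** Part (1) is the negation of membership in an intersection. Part (2) holds
    because every evaluation map is additive: if it kills [phi - psi], it takes
    the same value at [phi] and at [psi], so it vanishes at both or at neither. *)

Theorem proposition3p15 (k : fieldType) (char0 : [pchar k] =i pred0)
    (Omega : choiceType) (Omega_neq0 : inhabited Omega)
    (A : opAlg k Omega) (Y : choiceType) :
  (forall phi : freeOp A Y, (~` J_rho A Y)%classic phi ->
     exists f : Y -> A, ~ is_solution f phi) /\
  (forall phi psi : freeOp A Y, J_rho A Y (phi - psi) ->
     solution_set phi = solution_set psi).
Proof.
split=> [phi nJ|phi psi J].
  by apply/existsNP => sol; apply: nJ => f _; exact: sol.
have same f : eval_map f phi = eval_map f psi.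
  by apply/eqP; rewrite -subr_eq0 -algHomB; apply/eqP; exact: (J f).
by apply/funext => f; rewrite /solution_set /= /is_solution same.
Qed.
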